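(* Let $e_1 \geqslant e_2 \geqslant e_3$ be positive real numbers and let $T_{e_1,e_2,e_3}$ be the weighted $K_3$ whose three edges have weights $e_1,e_2,e_3$. Every graph of order $n$ with minimum degree at least $\delta(e_1,e_2,e_3)\,n$ has a fractional $T_{e_1,e_2,e_3}$-decomposition, where \[\delta(e_1,e_2,e_3) = \frac{1}{2}+\max\left\{\frac{e_3}{2e_1+2e_2-2e_3},\ \frac{e_2+e_3}{8e_1-2e_2-2e_3}\right\}.\]
   Context: A weighted graph $W$ consists of an underlying (simple) graph $U$ together with an assignment $w_W$ of positive real weights to the edges of $U$. A weighted graph $W'$ is a scaled copy of $W$ if there is a positive real $\alpha$ and an isomorphism $f$ between their underlying graphs with $w_{W'}(e)=\alpha\, w_W(f(e))$ for all edges $e$. A fractional $W$-decomposition of a graph $G$ is a finite collection of scaled copies of $W$, each with underlying graph a subgraph of $G$, such that for each edge $e$ of $G$ the sum of the weights assigned to $e$ by the members of the collection is exactly $1$. *)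

(* Defs.v *)
From HB Require Import structures.
From mathcomp Require Import all_boot all_order all_algebra.
From mathcomp Require Import reals.
Set Implicit Arguments.
Unset Strict Implicit.
Unset Printing Implicit Defensive.
Import Order.TTheory GRing.Theory Num.Theory.
Local Open Scope ring_scope.

(* The vertices form a subset of an ambient finite type, so that subgraphs of a
   graph on T are again graphs on T; an edge is a 2-element set of vertices. *)
Record graph (T : finType) := Graph {
  vertices : {set T};
  edges : {set {set T}};
  edgesP : forall e, e \in edges -> (e \subset vertices) && (#|e| == 2%N)
}.

Definition order_of (T : finType) (G : graph T) : nat := #|vertices G|.

Definition degree (T : finType) (G : graph T) (v : T) : nat :=
  #|[set e in edges G | v \in e]|.

(* The neutral value, the order of G, exceeds every degree, so it only matters
   for the null graph. *)
Definition min_degree (T : finType) (G : graph T) : nat :=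
  \big[minn/order_of G]_(v in vertices G) degree G v.

Definition subgraph (T : finType) (H G : graph T) : Prop :=
  (vertices H \subset vertices G) /\ (edges H \subset edges G).

Definition isomorphism (T T' : finType) (G : graph T) (H : graph T')
    (f : T -> T') : Prop :=
  [/\ {in vertices G &, injective f},
      f @: vertices G = vertices H
    & {in vertices G &, forall x y,
        ([set f x; f y] \in edges H) = ([set x; y] \in edges G)}].

(* Values of [weight] off the edges are irrelevant: every definition below
   consults it on edges only. *)
Record wgraph (R : realType) (T : finType) := WGraph {
  underlying : graph T;
  weight : {set T} -> R;
  weight_gt0 : forall e, e \in edges underlying -> 0 < weight e
}.

Definition scaled_copy (R : realType) (T T' : finType)
    (W : wgraph R T) (W' : wgraph R T') : Prop :=
  exists (alpha : R) (f : T' -> T),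
    [/\ 0 < alpha,
        isomorphism (underlying W') (underlying W) f
      & forall e, e \in edges (underlying W') ->
          weight W' e = alpha * weight W (f @: e)].

Definition fractional_decomposition (R : realType) (T T' : finType)
    (W : wgraph R T) (G : graph T') : Prop :=
  exists (k : nat) (D : 'I_k -> wgraph R T'),
    [/\ forall i, scaled_copy W (D i),
        forall i, subgraph (underlying (D i)) G
      & forall e, e \in edges G ->
          \sum_(i < k | e \in edges (underlying (D i))) weight (D i) e = 1].

Lemma complete_edgesP (m : nat) (e : {set 'I_m}) :
  e \in [set e : {set 'I_m} | #|e| == 2%N] ->
  (e \subset [set: 'I_m]) && (#|e| == 2%N).
Proof. by rewrite inE subsetT. Qed.

Definition complete_graph (m : nat) : graph 'I_m := Graph (@complete_edgesP m).

Definition triangle_weight (R : realType) (e1 e2 e3 : R) (e : {set 'I_3}) : R :=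
  if e == [set 0; 1] then e1 else if e == [set 1; 2] then e2 else e3.

Lemma triangle_weight_gt0 (R : realType) (e1 e2 e3 : R) :
  0 < e1 -> 0 < e2 -> 0 < e3 ->
  forall e, e \in edges (complete_graph 3) -> 0 < triangle_weight e1 e2 e3 e.
Proof.
by move=> h1 h2 h3 e _; rewrite /triangle_weight; case: ifP => // _; case: ifP.
Qed.

Definition weighted_triangle (R : realType) (e1 e2 e3 : R)
    (h1 : 0 < e1) (h2 : 0 < e2) (h3 : 0 < e3) : wgraph R 'I_3 :=
  WGraph (triangle_weight_gt0 h1 h2 h3).

Definition delta (R : realType) (e1 e2 e3 : R) : R :=
  2^-1 + Num.max (e3 / (2 * e1 + 2 * e2 - 2 * e3))
                 ((e2 + e3) / (8 * e1 - 2 * e2 - 2 * e3)).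

(* Main.v *)
(** By Farkas' lemma it suffices to show that the edge values [y] of [G] have a
    nonnegative sum whenever [e1 * y_ab + e2 * y_bc + e3 * y_ac >= 0] for every
    ordered triangle [abc].  Let [n] be the order, [d] the minimum degree and
    [p = 2d - n].  Deleting an edge of nonnegative value whose ends both have
    degree above [d] only lowers the sum, so one may assume that every edge of
    nonnegative value lies in at most [d] triangles; every edge lies in at least
    [p].  The degree condition says exactly that
    [(e2 + e3) d <= 2 e1 p] and [2 e3 d <= (e1 + e2) p], and these make
    [p * (positive part) >= d * (negative part)] hold in every triangle, according
    to whether it has one or two negative edges.  Summing over all triangles gives
    [p d * sum y >= 0]. *)
Require Import Defs.
From mathcomp Require Import all_boot all_order all_algebra.
From mathcomp Require Import reals boolp ring lra.
Set Implicit Arguments.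
Unset Strict Implicit.
Unset Printing Implicit Defensive.
Import Order.TTheory GRing.Theory Num.Theory.
Local Open Scope ring_scope.

(** * Farkas' lemma over an ordered field, for finitely many constraints *)

Section Farkas.
Variables (R : realFieldType) (I : finType).
Implicit Types u v x : I -> R.

Definition dot u x : R := \sum_i u i * x i.

Lemma dot_subZl u (a : R) v x :
  dot (fun i => u i - a * v i) x = dot u x - a * dot v x.
Proof.
rewrite /dot mulr_sumr -sumrB; apply: eq_bigr => i _.
by rewrite mulrBl mulrA.
Qed.

Lemma dot_subZr u (a : R) v x :
  dot u (fun i => x i - a * v i) = dot u x - a * dot u v.
Proof.
rewrite /dot mulr_sumr -sumrB; apply: eq_bigr => i _.
by rewrite mulrBr mulrCA.
Qed.

(* Bartl's induction on the number of constraints: a violator x0 of the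
   implication without the last constraint alpha0 has alpha0(x0) < 0, and
   projecting along x0 onto the kernel of alpha0 eliminates alpha0. *)
Lemma farkas_ord m (alpha : 'I_m -> I -> R) (gamma : I -> R) :
  (forall x, (forall j, 0 <= dot (alpha j) x) -> 0 <= dot gamma x) ->
  exists lambda : 'I_m -> R, (forall j, 0 <= lambda j) /\
    forall i, gamma i = \sum_j lambda j * alpha j i.
Proof.
elim: m alpha gamma => [|m IH] alpha gamma himp.
  exists (fun=> 0); split => // i; rewrite big_ord0.
  (* Without constraints, testing at [- gamma] forces the sum of squares of [gamma] to vanish. *)
  have : 0 <= dot gamma (fun i => - gamma i) by apply: himp; case.
  rewrite /dot => h.
  have h' : \sum_i gamma i * gamma i <= 0.
    by rewrite -oppr_ge0 -sumrN; under eq_bigr do rewrite -mulrN.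
  have hs : \sum_i gamma i * gamma i == 0.
    by rewrite eq_le h' sumr_ge0 // => k _; rewrite -expr2 sqr_ge0.
  move: hs; rewrite psumr_eq0; last by move=> k _; rewrite -expr2 sqr_ge0.
  by move/allP/(_ i (mem_index_enum i)); rewrite mulf_eq0 orbb => /eqP.
set beta := fun j => alpha (lift ord0 j).
have [hred|hnred] := pselect (forall x, (forall j, 0 <= dot (beta j) x) ->
    0 <= dot gamma x).
  have [la [la0 hla]] := IH beta gamma hred.
  exists (fun j => if unlift ord0 j is Some k then la k else 0); split.
    by move=> j; case: unliftP.
  move=> i; rewrite big_ord_recl unlift_none mul0r add0r hla.
  by apply: eq_bigr => j _; rewrite liftK.
have [x0 /not_implyP[hx0 /negP]] : exists x,
    ~ ((forall j, 0 <= dot (beta j) x) -> 0 <= dot gamma x).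
  exact/existsNP.
rewrite -ltNge => gx0; set a := dot (alpha ord0) x0.
have a_lt0 : a < 0.
  rewrite ltNge; apply/negP => a_ge0; move: gx0; rewrite ltNge => /negP; apply.
  apply: himp => j; case: (unliftP ord0 j) => [k|] ->; first exact: hx0.
  exact: a_ge0.
have c_le0 j : dot (beta j) x0 / a <= 0.
  by rewrite mulr_ge0_le0 // invr_le0 ltW.
have g_ge0 : 0 <= dot gamma x0 / a by rewrite ltW // nmulr_rgt0 // invr_lt0.
pose proj u := fun i => u i - dot u x0 / a * alpha ord0 i.
(* The projection is moved from [u] to [x]; the moved vector lies in the kernel of [alpha ord0], so
   [himp] applies to it. *)
have projE u x : dot (proj u) x =
    dot u (fun i => x i - dot (alpha ord0) x / a * x0 i).
  rewrite dot_subZl dot_subZr; congr (_ - _).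
  by rewrite mulrAC [RHS]mulrAC [X in X / _]mulrC.
have [la [la0 hla]] : exists lambda : 'I_m -> R, (forall j, 0 <= lambda j) /\
    forall i, proj gamma i = \sum_j lambda j * proj (beta j) i.
  apply: IH => x hx; rewrite projE; apply: himp => j.
  case: (unliftP ord0 j) => [k|] ->; first by rewrite -projE; exact: hx.
  by rewrite dot_subZr -/a divfK ?subrr // lt_eqF.
(* Expanding the projections in [hla] forces this coefficient of [alpha ord0]; [g_ge0] and [c_le0]
   make it nonnegative. *)
exists (fun j => if unlift ord0 j is Some k then la k else
  dot gamma x0 / a - \sum_k la k * (dot (beta k) x0 / a)); split.
  move=> j; case: unliftP => // _; rewrite subr_ge0; apply: le_trans g_ge0.
  by apply: sumr_le0 => k _; rewrite mulr_ge0_le0.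
move=> i; rewrite big_ord_recl unlift_none.
under [X in _ + X]eq_bigr do rewrite liftK.
have /eqP := hla i; rewrite /proj subr_eq => /eqP ->.
rewrite mulrBl addrC -addrA; congr (_ + _).
rewrite mulr_suml [RHS]addrC -sumrB.
by apply: eq_bigr => j _; rewrite mulrBr !mulrA.
Qed.

Lemma farkas (J : finType) (alpha : J -> I -> R) (gamma : I -> R) :
  (forall x, (forall j, 0 <= dot (alpha j) x) -> 0 <= dot gamma x) ->
  exists lambda : J -> R, (forall j, 0 <= lambda j) /\
    forall i, gamma i = \sum_j lambda j * alpha j i.
Proof.
move=> himp; have [x hx|la [la0 hla]] :=
    @farkas_ord #|J| (fun k => alpha (enum_val k)) gamma.
  by apply: himp => j; have := hx (enum_rank j); rewrite enum_rankK.
exists (fun j => la (enum_rank j)); split=> [//|i].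
rewrite hla (big_enum_val (fun j => la (enum_rank j) * alpha j i)).
by apply: eq_bigr => k _; rewrite enum_valK.
Qed.
End Farkas.

(** * Degrees, codegrees and double counting of edges and triangles *)

Section Counting.
Variable T : finType.
Implicit Types (G : graph T) (a b c v : T) (e : {set T}).

Definition neighbours G v : {set T} := [set w | [set v; w] \in edges G].

Lemma card_edge G e : e \in edges G -> #|e| = 2%N.
Proof. by move/edgesP => /andP[_ /eqP]. Qed.

Lemma edge_neq G a b : [set a; b] \in edges G -> a != b.
Proof. by move/card_edge; rewrite cards2; case: eqP. Qed.

Lemma edge_vertex G e v : e \in edges G -> v \in e -> v \in vertices G.
Proof. by move/edgesP => /andP[/subsetP he _] /he. Qed.

Lemma pair_inj G v : {in neighbours G v &, injective (fun w => [set v; w])}.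
Proof.
move=> w w'; rewrite !inE => /edge_neq hw _ /setP/(_ w).
by rewrite !inE eqxx orbT eq_sym (negPf hw) => /esym/eqP.
Qed.

Lemma incident_edges G v :
  [set e in edges G | v \in e] = (fun w => [set v; w]) @: neighbours G v.
Proof.
apply/setP => e; rewrite inE; apply/andP/imsetP => [[he hv]|[w hw ->]].
  have /eqP/cards2P[x [y [_ exy]]] := card_edge he.
  move: hv he; rewrite exy !inE => /orP[] /eqP <- he.
    by exists y; rewrite ?inE.
  by exists x; rewrite ?inE setUC.
by move: hw; rewrite !inE eqxx.
Qed.

Lemma degreeE G v : degree G v = #|neighbours G v|.
Proof. by rewrite /degree incident_edges card_in_imset //; exact: pair_inj. Qed.

Lemma sum_edges (R : nmodType) G (F : {set T} -> R) :
  \sum_v \sum_(w in neighbours G v) F [set v; w] =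
  (\sum_(e in edges G) F e) *+ 2.
Proof.
under eq_bigr => v _.
  rewrite -(big_imset F (@pair_inj G v)) -incident_edges.
  under eq_bigl do rewrite inE.
  over.
rewrite (exchange_big_dep (mem (edges G))) /=; last by move=> v e _ /andP[].
rewrite -sumrMnl; apply: eq_bigr => e he.
under eq_bigl do rewrite he /=.
by rewrite sumr_const (card_edge he).
Qed.

Lemma min_degree_le G v : v \in vertices G -> (min_degree G <= degree G v)%N.
Proof.
move=> hv; rewrite /min_degree.
elim: (index_enum T) (mem_index_enum v) => // w s IH.
rewrite inE big_cons => /predU1P[<-|/IH hs]; first by rewrite hv geq_minl.
by case: ifP => // _; apply: leq_trans hs; exact: geq_minr.
Qed.

Definition codegree G a b : nat := #|neighbours G a :&: neighbours G b|.

(** Inclusion-exclusion: the union of the two neighbourhoods lies in the vertex set. The additive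
    form avoids truncated subtraction. *)
Lemma codegree_ge G d a b : (forall v, v \in vertices G -> d <= degree G v)%N ->
  [set a; b] \in edges G -> (d + d <= order_of G + codegree G a b)%N.
Proof.
move=> hd hab; rewrite /codegree.
have ha : (d <= #|neighbours G a|)%N.
  by rewrite -degreeE hd // (edge_vertex hab) // !inE eqxx.
have hb : (d <= #|neighbours G b|)%N.
  by rewrite -degreeE hd // (edge_vertex hab) // !inE eqxx orbT.
apply: leq_trans (leq_add ha hb) _; rewrite -cardsUI leq_add2r.
apply/subset_leq_card/subsetP => w; rewrite !inE => /orP[] hw.
  by rewrite (edge_vertex hw) // !inE eqxx orbT.
by rewrite (edge_vertex hw) // !inE eqxx orbT.
Qed.

Lemma del_edgeP G e : forall e', e' \in edges G :\ e ->
  (e' \subset vertices G) && (#|e'| == 2%N).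
Proof. by move=> e' /setD1P[_ /edgesP]. Qed.

Definition del_edge G e : graph T := Graph (@del_edgeP G e).

Lemma degree_del_edge G e v : e \in edges G ->
  degree G v = ((v \in e) + degree (del_edge G e) v)%N.
Proof.
move=> he; rewrite /degree (cardsD1 e) inE he /=; congr (_ + _)%N.
by apply: eq_card => e'; rewrite !inE andbA.
Qed.

(* Each edge of a triangle is counted once in each of the three positions. *)
Lemma sum_triangles_ge0 (R : numDomainType) G (f : {set T} -> R) :
  (forall a b c, [set a; b] \in edges G -> [set b; c] \in edges G ->
     [set a; c] \in edges G -> 0 <= f [set a; b] + f [set b; c] + f [set a; c]) ->
  0 <= \sum_a \sum_(b in neighbours G a) f [set a; b] *+ codegree G a b.
Proof.
move=> hf.
pose tri a b c := [&& [set a; b] \in edges G, [set b; c] \in edges G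
  & [set a; c] \in edges G].
pose H a b c := if tri a b c then f [set a; b] else 0.
have -> : \sum_a \sum_(b in neighbours G a) f [set a; b] *+ codegree G a b =
    \sum_a \sum_b \sum_c H a b c.
  apply: eq_bigr => a _; rewrite big_mkcond; apply: eq_bigr => b _ /=.
  rewrite -sumr_const inE /H /tri; case: ifP => _ /=; last first.
    by rewrite big1.
  rewrite big_mkcond; apply: eq_bigr => c _ /=; by rewrite !inE andbC.
have H1 : \sum_a \sum_b \sum_c H a b c = \sum_a \sum_b \sum_c H b c a.
  rewrite [RHS]exchange_big; apply: eq_bigr => a _.
  by rewrite [RHS]exchange_big.
have H2 : \sum_a \sum_b \sum_c H a b c = \sum_a \sum_b \sum_c H a c b.
  by apply: eq_bigr => a _; rewrite exchange_big.
(* The sum is tripled, and [H1] and [H2] relabel two of the copies, so that each ordered triangle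
   contributes all three of its edges. *)
rewrite -(pmulrn_lge0 _ (isT : (0 < 3)%N)) !mulrS mulr0n addr0.
rewrite {2}H1 {2}H2 -!big_split sumr_ge0 // => a _.
rewrite -!big_split sumr_ge0 // => b _; rewrite -!big_split sumr_ge0 // => c _.
rewrite /= /H /tri [in [set c; a]]setUC [in [set c; b]]setUC [in [set b; a]]setUC.
case: (boolP ([set a; b] \in _)) => hab; case: (boolP ([set b; c] \in _)) => hbc;
  case: (boolP ([set a; c] \in _)) => hac //=; rewrite ?addr0 //.
by rewrite addrA hf.
Qed.
End Counting.

(** * The dual inequality: nonnegativity of the edge sum *)

Section Dual.
Variables (R : realFieldType) (e1 e2 e3 : R).
Hypotheses (h1 : 0 < e1) (h2 : 0 < e2) (h3 : 0 < e3).

(* With d the minimum degree and p = 2d - n: a negative edge lies in at least p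
   triangles and a nonnegative one in at most d (after deletions), so that t
   triangles contribute at most t * penalty p d v <= p * d * v. *)
Definition penalty (p d v : R) : R := if 0 <= v then p * v else d * v.

Lemma penalty_bound (p d t v : R) : 0 <= p -> 0 <= d -> p <= t ->
  (0 <= v -> t <= d) -> penalty p d v * t <= p * d * v.
Proof.
move=> p0 d0 pt; rewrite /penalty; case: leP => hv td.
  by rewrite -!mulrA ler_wpM2l // mulrC ler_wpM2r // td.
rewrite [p * d]mulrC -!mulrA ler_wpM2l // [p * v]mulrC.
by rewrite ler_wnM2l // ltW.
Qed.

(** Here [a] is the negative edge and [s] the sum of the other two; the last hypothesis adds the two
    triangle constraints giving [a] the weight [e1]. Taking [d] times it plus [s] times the degree
    condition yields [2 * e1] times the claim. *)
Lemma one_negative (p d a s : R) : 0 <= d -> 0 <= s ->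
  (e2 + e3) * d <= 2 * e1 * p -> 0 <= 2 * e1 * a + (e2 + e3) * s ->
  0 <= d * a + p * s.
Proof.
move=> d0 s0 hp ha; rewrite -(pmulr_rge0 _ h1).
have := mulr_ge0 d0 ha.
have : 0 <= s * (2 * e1 * p - (e2 + e3) * d) by rewrite mulr_ge0 ?subr_ge0.
lra.
Qed.

(** The same combination with [b] the nonnegative edge, given the weight [e3], and [s] the sum of
    the two negative ones. *)
Lemma two_negative (p d b s : R) : 0 <= d -> 0 <= b ->
  2 * e3 * d <= (e1 + e2) * p -> 0 <= (e1 + e2) * s + 2 * e3 * b ->
  0 <= d * s + p * b.
Proof.
move=> d0 b0 hp hs; rewrite -(pmulr_rge0 _ (addr_gt0 h1 h2)).
have := mulr_ge0 d0 hs.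
have : 0 <= b * ((e1 + e2) * p - 2 * e3 * d) by rewrite mulr_ge0 ?subr_ge0.
lra.
Qed.

Lemma penalty_triangle (p d a b c : R) : 0 <= p -> 0 <= d ->
  (e2 + e3) * d <= 2 * e1 * p -> 2 * e3 * d <= (e1 + e2) * p ->
  [/\ 0 <= e1 * a + e2 * b + e3 * c, 0 <= e1 * a + e2 * c + e3 * b
    & 0 <= e1 * b + e2 * a + e3 * c] ->
  [/\ 0 <= e1 * b + e2 * c + e3 * a, 0 <= e1 * c + e2 * a + e3 * b
    & 0 <= e1 * c + e2 * b + e3 * a] ->
  0 <= penalty p d a + penalty p d b + penalty p d c.
Proof.
move=> p0 d0 hp1 hp2 [abc acb bac] [bca cab cba]; rewrite /penalty.
case: (leP 0 a) => ha; case: (leP 0 b) => hb; case: (leP 0 c) => hc.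
- by rewrite !addr_ge0 ?mulr_ge0.
- have := @one_negative p d c (a + b) d0 (addr_ge0 ha hb) hp1; lra.
- have := @one_negative p d b (a + c) d0 (addr_ge0 ha hc) hp1; lra.
- have := @two_negative p d a (b + c) d0 ha hp2; lra.
- have := @one_negative p d a (b + c) d0 (addr_ge0 hb hc) hp1; lra.
- have := @two_negative p d b (a + c) d0 hb hp2; lra.
- have := @two_negative p d c (a + b) d0 hc hp2; lra.
(* Three negative edges would violate the constraint [abc]. *)
have na := mulr_gt0 h1 (_ : 0 < - a); have nb := mulr_gt0 h2 (_ : 0 < - b).
have nc := mulr_gt0 h3 (_ : 0 < - c).
move: na nb nc; rewrite !oppr_gt0 => /(_ ha) na /(_ hb) nb /(_ hc) nc; lra.
Qed.

Lemma edge_sum_ge0 (T : finType) (G : graph T) (d : nat) (y : {set T} -> R) :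
  (forall v, v \in vertices G -> d <= degree G v)%N ->
  (e2 + e3) * d%:R <= 2 * e1 * (2 * d%:R - (order_of G)%:R) ->
  2 * e3 * d%:R <= (e1 + e2) * (2 * d%:R - (order_of G)%:R) ->
  (forall a b c, [set a; b] \in edges G -> [set b; c] \in edges G ->
    [set a; c] \in edges G ->
    0 <= e1 * y [set a; b] + e2 * y [set b; c] + e3 * y [set a; c]) ->
  0 <= \sum_(e in edges G) y e.
Proof.
have [m] := ubnP #|edges G|; elim: m G => // m IH G.
rewrite ltnS => hm hd; set p := 2 * d%:R - _ => hp1 hp2 hy.
have d0 : 0 <= d%:R :> R by rewrite ler0n.
have p0 : 0 <= p.
  by rewrite -(pmulr_rge0 _ h1); have := mulr_ge0 (ltW (addr_gt0 h2 h3)) d0; lra.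
(* Deleting such an edge keeps the vertex set and all degrees at least [d], hence also [p], and
   creates no triangle, so the induction hypothesis applies. *)
have [/exists_inP[e he /andP[ye /forall_inP hde]]|hndel] :=
    boolP [exists e in edges G, (0 <= y e) && [forall v in e, d < degree G v]%N].
  rewrite (big_setD1 e) //= addr_ge0 //.
  apply: (IH (del_edge G e)) => //.
  - by move: hm; rewrite (cardsD1 e) he.
  - move=> v hv; have := hd _ hv; have := hde v.
    rewrite (degree_del_edge v he); case: (v \in e) => //=.
    by move=> /(_ isT).
  - by move=> a b c /setD1P[_ hab] /setD1P[_ hbc] /setD1P[_ hac]; apply: hy.
(* With no deletable edge left, a nonnegative edge has an end of degree at most [d], which bounds
   its codegree. *)
have codeg_le a b : [set a; b] \in edges G -> 0 <= y [set a; b] ->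
    (codegree G a b <= d)%N.
  move=> hab yab; move: hndel; rewrite negb_exists_in => /forall_inP/(_ _ hab).
  rewrite yab /= negb_forall_in => /exists_inP[v]; rewrite !inE -leqNgt degreeE.
  move=> /orP[] /eqP -> hv; apply: leq_trans hv; apply: subset_leq_card.
    exact: subsetIl.
  exact: subsetIr.
(* The final step cancels [p * d], so [d = 0] is separate: there [0 <= p] forces the null graph. *)
have [d_eq0|d_gt0] := posnP d.
  have n_eq0 : order_of G = 0%N.
    apply/eqP; move: p0; rewrite /p d_eq0 mulr0 sub0r oppr_ge0.
    by rewrite lern0.
  rewrite big1 // => e he.
  have /eqP/cards2P[a [b [_ eab]]] := card_edge he.
  have : a \in vertices G by rewrite (edge_vertex he) // eab !inE eqxx.
  by rewrite (cards0_eq n_eq0) inE.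
have dR : 0 < d%:R :> R by rewrite ltr0n.
have pR : 0 < p.
  rewrite -(pmulr_rgt0 _ (addr_gt0 h1 h2)); apply: lt_le_trans hp2.
  by rewrite !mulr_gt0.
have pdR := mulr_gt0 pR dR.
(* Doubling turns the sum over edges into one over ordered adjacent pairs, to be compared termwise
   with the penalties weighted by codegree. *)
rewrite -(pmulr_rge0 _ pdR) -(pmulrn_lge0 _ (isT : (0 < 2)%N)) mulr_sumr.
rewrite -(sum_edges G (fun e => p * d%:R * y e)).
apply: le_trans (_ : 0 <= \sum_a \sum_(b in neighbours G a)
  penalty p d%:R (y [set a; b]) *+ codegree G a b) _.
  apply: (sum_triangles_ge0 (f := fun e => penalty p d%:R (y e))).
  move=> a b c hab hbc hac.
  have [hba hcb hca] : [/\ [set b; a] \in edges G, [set c; b] \in edges G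
    & [set c; a] \in edges G] by split; rewrite setUC.
  have := hy _ _ _ hab hbc hac; have := hy _ _ _ hba hac hbc.
  have := hy _ _ _ hbc hca hba; have := hy _ _ _ hcb hba hca.
  have := hy _ _ _ hac hcb hab; have := hy _ _ _ hca hab hcb.
  rewrite ![[set b; a]]setUC ![[set c; b]]setUC ![[set c; a]]setUC.
  by move=> *; apply: penalty_triangle.
apply: ler_sum => a _; apply: ler_sum => b; rewrite inE => hab.
rewrite -[leLHS]mulr_natr penalty_bound // ?ler_nat //; last first.
  exact: codeg_le.
have := codegree_ge hd hab; rewrite -(ler_nat R) !natrD /p => ?; lra.
Qed.
End Dual.

(** * Scaled copies of the weighted triangle on prescribed vertices *)

Section Copies.
Variables (R : realType) (T : finType).
Implicit Types x y z : T.

Definition triangle_edges x y z := [set [set x; y]; [set y; z]; [set x; z]].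

Lemma pair_eqF (S : finType) (a b c d : S) :
  a != c -> a != d -> ([set a; b] == [set c; d]) = false.
Proof.
move=> ac ad; apply/negP => /eqP/setP/(_ a).
by rewrite !inE eqxx (negPf ac) (negPf ad).
Qed.

Lemma triangle_edges_neq (S : finType) (a b c : S) :
  a != b -> b != c -> a != c ->
  [/\ ([set a; b] == [set b; c]) = false, ([set a; b] == [set a; c]) = false
    & ([set b; c] == [set a; c]) = false].
Proof.
move=> ab bc ac; split; first by rewrite pair_eqF.
  by rewrite [[set a; b]]setUC pair_eqF // eq_sym.
by rewrite pair_eqF // eq_sym.
Qed.

Lemma two_subset_triangle x y z (e : {set T}) :
  e \subset [set x; y; z] -> #|e| == 2%N -> e \in triangle_edges x y z.
Proof.
move=> /subsetP he /cards2P[a [b [hab eab]]].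
have := he a; have := he b; rewrite /triangle_edges eab !inE !eqxx orbT /=.
move=> /(_ isT) hb /(_ isT) ha.
move: ha hb hab => /orP[/orP[]|] /eqP -> /orP[/orP[]|] /eqP ->;
  by rewrite ?eqxx // => _; rewrite ?eqxx ?orbT // setUC eqxx ?orbT.
Qed.

Lemma triangle_graphP x y z (e : {set T}) :
  e \in [set e : {set T} | (e \subset [set x; y; z]) && (#|e| == 2%N)] ->
  (e \subset [set x; y; z]) && (#|e| == 2%N).
Proof. by rewrite inE. Qed.

(** Taking all 2-subsets as edges gives a graph even when the vertices coincide. *)
Definition triangle_graph x y z : graph T := Graph (@triangle_graphP x y z).

Lemma edges_triangle_graph x y z : x != y -> y != z -> x != z ->
  edges (triangle_graph x y z) = triangle_edges x y z.
Proof.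
move=> xy yz xz; apply/setP => e; apply/idP/idP; rewrite inE.
  by case/andP; exact: two_subset_triangle.
rewrite !inE => /orP[/orP[]|] /eqP ->; rewrite cards2 ?xy ?yz ?xz andbT;
  by apply/subsetP => v; rewrite !inE => /orP[] /eqP ->; rewrite eqxx ?orbT.
Qed.

(** The isomorphism onto [complete_graph 3], sending xy, yz, xz to the edges of weight [e1], [e2],
    [e3]. It is injective on the triangle only, since every vertex besides [x] and [y] gets 2. *)
Definition triangle_label x y v : 'I_3 :=
  if v == x then 0 else if v == y then 1 else 2.

Variables (e1 e2 e3 : R) (h1 : 0 < e1) (h2 : 0 < e2) (h3 : 0 < e3).

Lemma triangle_copy_gt0 x y z (la : R) (hla : 0 < la) (e : {set T}) :
  e \in edges (triangle_graph x y z) ->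
  0 < la * triangle_weight e1 e2 e3 (triangle_label x y @: e).
Proof.
by move=> _; rewrite mulr_gt0 // /triangle_weight; do 2?case: ifP.
Qed.

Definition triangle_copy x y z (la : R) (hla : 0 < la) : wgraph R T :=
  WGraph (triangle_copy_gt0 (x := x) (y := y) (z := z) hla).

Lemma triangle_labelE x y z : x != y -> y != z -> x != z ->
  [/\ triangle_label x y x = 0, triangle_label x y y = 1
    & triangle_label x y z = 2].
Proof.
by move=> xy yz xz; rewrite /triangle_label !eqxx ![_ == x]eq_sym [z == y]eq_sym
  (negPf xy) (negPf yz) (negPf xz).
Qed.

Lemma triangle_copy_scaled x y z la (hla : 0 < la) :
  x != y -> y != z -> x != z ->
  scaled_copy (weighted_triangle h1 h2 h3) (triangle_copy x y z hla).
Proof.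
move=> xy yz xz; exists la, (triangle_label x y); split=> //.
have [lx ly lz] := triangle_labelE xy yz xz.
have inj : {in [set x; y; z] &, injective (triangle_label x y)}.
  move=> a b; rewrite !inE => /orP[/orP[]|] /eqP -> /orP[/orP[]|] /eqP ->;
  by rewrite ?lx ?ly ?lz.
split=> //=.
  apply/setP => i; rewrite inE; apply/imsetP.
  case: i => [[|[|[|//]]] hi]; [exists x | exists y | exists z];
    by rewrite ?inE ?eqxx ?orbT // ?lx ?ly ?lz; apply: val_inj.
move=> a b ha hb; rewrite !inE !cards2 (inj_in_eq inj) //.
rewrite [X in _ = X && _](_ : _ = true) //.
by apply/subsetP => v; rewrite !inE => /orP[] /eqP ->; move: ha hb; rewrite !inE.
Qed.

Lemma triangle_copy_weight x y z la (hla : 0 < la) (e : {set T}) :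
  x != y -> y != z -> x != z -> e \in triangle_edges x y z ->
  weight (triangle_copy x y z hla) e =
  la * (e1 * (e == [set x; y])%:R + e2 * (e == [set y; z])%:R
        + e3 * (e == [set x; z])%:R).
Proof.
move=> xy yz xz; have [lx ly lz] := triangle_labelE xy yz xz.
have [xy_yz xy_xz yz_xz] := triangle_edges_neq xy yz xz.
have [E01_12 E01_02 E12_02] :=
  @triangle_edges_neq 'I_3 0 1 2 isT isT isT.
rewrite !inE => /orP[/orP[]|] /eqP -> /=; congr (_ * _);
  rewrite imsetU1 imset_set1 ?lx ?ly ?lz /triangle_weight !eqxx.
- by rewrite xy_yz xy_xz mulr1 !mulr0 !addr0.
- by rewrite eq_sym E01_12 [[set y; z] == _]eq_sym xy_yz yz_xz mulr1 !mulr0 addr0 add0r.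
- rewrite ![[set 0; 2] == _]eq_sym E01_02 E12_02.
  by rewrite ![[set x; z] == _]eq_sym xy_xz yz_xz mulr1 !mulr0 !add0r.
Qed.
End Copies.

(** * From a conic combination of triangle vectors to a decomposition *)

Section Decomposition.
Variables (R : realType) (e1 e2 e3 : R).
Hypotheses (h1 : 0 < e1) (h2 : 0 < e2) (h3 : 0 < e3).
Variables (T : finType) (G : graph T).

Definition is_triangle (j : T * T * T) : bool :=
  [&& [set j.1.1; j.1.2] \in edges G, [set j.1.2; j.2] \in edges G
    & [set j.1.1; j.2] \in edges G].

(** Non-triangles get the zero vector, so that the Farkas constraints can be indexed by all
    triples. *)
Definition triangle_vector (j : T * T * T) (e : {set T}) : R :=
  if is_triangle j then
    e1 * (e == [set j.1.1; j.1.2])%:R + e2 * (e == [set j.1.2; j.2])%:R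
    + e3 * (e == [set j.1.1; j.2])%:R
  else 0.

Lemma dot_triangle_vector j (y : {set T} -> R) : is_triangle j ->
  dot (triangle_vector j) y = e1 * y [set j.1.1; j.1.2]
    + e2 * y [set j.1.2; j.2] + e3 * y [set j.1.1; j.2].
Proof.
have pick c f : \sum_e c * (e == f)%:R * y e = c * y f.
  rewrite (bigD1 f) //= eqxx mulr1 big1 ?addr0 // => e /negPf ->.
  by rewrite mulr0 mul0r.
move=> hj; rewrite /dot /triangle_vector hj -!pick -!big_split.
by apply: eq_bigr => e _; rewrite /= -!mulrDl.
Qed.

Lemma decomposition_of_cone (la : T * T * T -> R) :
  (forall j, 0 <= la j) ->
  (forall e, (e \in edges G)%:R = \sum_j la j * triangle_vector j e) ->
  fractional_decomposition (weighted_triangle h1 h2 h3) G.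
Proof.
move=> la0 hla.
(* Scale factors must be positive, so triples with zero coefficient are discarded. *)
pose P := [pred j | is_triangle j && (0 < la j)].
have laP (i : 'I_#|P|) : 0 < la (enum_val i).
  by have /andP[] := enum_valP i.
pose D (i : 'I_#|P|) := let j := enum_val i in
  triangle_copy h1 h2 h3 j.1.1 j.1.2 j.2 (laP i).
have neqP (i : 'I_#|P|) : let j := enum_val i in
    [/\ j.1.1 != j.1.2, j.1.2 != j.2 & j.1.1 != j.2].
  have /andP[/and3P[hxy hyz hxz] _] := enum_valP i.
  by split; [exact: edge_neq hxy | exact: edge_neq hyz | exact: edge_neq hxz].
exists #|P|, D; split=> [i|i|e he].
- have [xy yz xz] := neqP i; exact: triangle_copy_scaled.
- have /andP[/and3P[hxy hyz hxz] _] := enum_valP i; have [xy yz xz] := neqP i.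
  split.
    apply/subsetP => v /setUP[/setUP[]|] /set1P ->.
    + by rewrite (edge_vertex hxy) // !inE eqxx.
    + by rewrite (edge_vertex hxy) // !inE eqxx orbT.
    + by rewrite (edge_vertex hyz) // !inE eqxx orbT.
  rewrite edges_triangle_graph //.
  by apply/subsetP => e /setUP[/setUP[]|] /set1P ->.
have -> : 1 = \sum_j la j * triangle_vector j e by rewrite -hla he.
have -> : \sum_j la j * triangle_vector j e =
    \sum_(j in P) la j * triangle_vector j e.
  rewrite [RHS]big_mkcond; apply: eq_bigr => j _; rewrite inE /triangle_vector.
  case: (is_triangle j) => /=; last by rewrite mulr0.
  by have := la0 j; rewrite le_eqVlt => /predU1P[<-|->]; rewrite ?mul0r ?if_same.
rewrite [RHS]big_enum_val [LHS]big_mkcond; apply: eq_bigr => i _.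
have [xy yz xz] := neqP i; have /andP[tri _] := enum_valP i.
rewrite edges_triangle_graph //; case: ifPn => hei.
  by rewrite triangle_copy_weight // /triangle_vector tri.
move: hei; rewrite /triangle_vector tri !inE !negb_or => /andP[/andP[]].
by do 3!move=> /negPf ->; rewrite !mulr0 !addr0 mulr0.
Qed.
End Decomposition.

Lemma half_add_div_le (R : realFieldType) (q c x d : R) : 0 < c ->
  (2^-1 + q / c) * x <= d -> (c + 2 * q) * x <= 2 * c * d.
Proof.
move=> c0; rewrite -(ler_pM2l (mulr_gt0 (ltr0Sn R 1) c0)) mulrA.
have c_neq0 : c != 0 by rewrite gt_eqF.
by have -> : 2 * c * (2^-1 + q / c) = c + 2 * q by field.
Qed.

Lemma delta_bounds (R : realType) (e1 e2 e3 n d : R) :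
  0 < e1 -> 0 < e3 -> e2 <= e1 -> e3 <= e2 -> 0 <= n ->
  delta e1 e2 e3 * n <= d ->
  (e2 + e3) * d <= 2 * e1 * (2 * d - n) /\
  2 * e3 * d <= (e1 + e2) * (2 * d - n).
Proof.
move=> h1 h3 h21 h32 n0 hdeg.
have c1 : 0 < 2 * e1 + 2 * e2 - 2 * e3 by clear -h1 h21 h32; lra.
have c2 : 0 < 8 * e1 - 2 * e2 - 2 * e3 by clear -h1 h21 h32; lra.
have b1 : (2^-1 + e3 / (2 * e1 + 2 * e2 - 2 * e3)) * n <= d.
  by apply: le_trans hdeg; rewrite ler_wpM2r // lerD2l le_max lexx.
have b2 : (2^-1 + (e2 + e3) / (8 * e1 - 2 * e2 - 2 * e3)) * n <= d.
  by apply: le_trans hdeg; rewrite ler_wpM2r // lerD2l le_max lexx orbT.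
(* The left factors [c + 2 * q] collapse to [2 * e1 + 2 * e2] and [8 * e1]; the rest is linear
   rearrangement. *)
have := half_add_div_le c1 b1; have := half_add_div_le c2 b2.
by clear; lra.
Qed.

Theorem theorem1p2 (R : realType) (e1 e2 e3 : R)
    (h1 : 0 < e1) (h2 : 0 < e2) (h3 : 0 < e3)
    (h21 : e2 <= e1) (h32 : e3 <= e2)
    (n : nat) (T : finType) (G : graph T)
    (hn : order_of G = n)
    (hdeg : delta e1 e2 e3 * n%:R <= (min_degree G)%:R) :
  fractional_decomposition (weighted_triangle h1 h2 h3) G.
Proof.
have [hp1 hp2] := delta_bounds h1 h3 h21 h32 (ler0n R n) hdeg.
(* The target is the indicator of the edge set, whose pairing with [y] is the edge sum. *)
have [|la [la0 hla]] := @farkas R _ _ (triangle_vector e1 e2 e3 G)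
    (fun e => (e \in edges G)%:R).
  move=> y hy; have -> : dot (fun e => (e \in edges G)%:R) y =
      \sum_(e in edges G) y e.
    rewrite /dot [RHS]big_mkcond; apply: eq_bigr => e _.
    by case: ifP; rewrite ?mul1r ?mul0r.
  apply: (edge_sum_ge0 h1 h2 h3 (d := min_degree G)).
  - exact: min_degree_le.
  - by rewrite hn.
  - by rewrite hn.
  move=> a b c hab hbc hac; have := hy (a, b, c).
  by rewrite dot_triangle_vector // /is_triangle hab hbc hac.
exact: decomposition_of_cone hla.
Qed.
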